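(* Let $(X,T)$ be any dynamical system and let $\mu\in M_{erg}(X)$. Then $\mu$ is an equilibrium state for some potential $\phi\in C(X)$ if and only if $\mu$ is the freezing state for some potential, i.e. there exists $\psi\in C(X)$ that freezes at $\mu$.
   Context: A dynamical system $(X,T)$ consists of a compact metric space $X$ and a continuous action $T=\{T_g\}_{g\in G}$ of a topological (semi)group $G$ on $X$ (continuous maps $T_g:X\to X$ with $T_g\circ T_h=T_{gh}$). $M_T(X)$ is the set of $T$-invariant Borel probability measures on $X$, with the weak-$*$ topology; $M_{erg}(X)\subset M_T(X)$ is the set of ergodic measures. Standing assumptions: $M_T(X)\neq\emptyset$; a measure-theoretic (Kolmogorov-Sinai) entropy $h(\mu)$ is defined for every $\mu\in M_T(X)$ (as is the case when $G$ is amenable), and $h:M_T(X)\to\mathbb{R}$ is non-negative and affine; and the topological entropy $h(X)=\sup\{h(\mu):\mu\in M_T(X)\}$ is finite. $C(X)$ is the space of real-valued continuous functions (potentials) on $X$. The pressure of $\phi\in C(X)$ is $P(\phi)=\sup\{h(\mu)+\int\phi\,d\mu:\mu\in M_T(X)\}$, and $\mu\in M_T(X)$ is an equilibrium state for $\phi$ if $P(\phi)=h(\mu)+\int\phi\,d\mu$. A potential $\phi$ freezes at $\mu$ if there exists $\beta_0>0$ such that for all $\beta\ge\beta_0$, $\mu$ is an equilibrium state for $\beta\phi$. *)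

(* Defs.v *)
From HB Require Import structures.
From mathcomp Require Import all_boot all_order all_algebra.
From mathcomp Require Import all_classical all_reals all_analysis.

Set Implicit Arguments.
Unset Strict Implicit.
Unset Printing Implicit Defensive.

Import Order.TTheory GRing.Theory Num.Theory.
Import numFieldNormedType.Exports.

Local Open Scope classical_set_scope.
Local Open Scope ring_scope.

HB.mixin Record isTopologicalSemigroup G of Semigroup G & Topological G := {
  mulg_continuous : continuous (fun p : G * G => (p.1 * p.2)%g)
}.

#[short(type="topologicalSemigroupType")]
HB.structure Definition TopologicalSemigroup :=
  {G of Semigroup G & Topological G & isTopologicalSemigroup G}.

(* Measurable types are pointed in the library. The base point plays no other
   role, and it costs no generality: a space carrying a probability measure is
   nonempty. *)
#[short(type="pmetricType")]
HB.structure Definition PointedMetric (K : numDomainType) :=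
  {M of Metric K M & Pointed M}.

Notation borel X := (g_sigma_algebraType (@open X)).

Section Dynamics.
Context {R : realType} {X : pmetricType R} {G : topologicalSemigroupType}.

Definition continuous_action (T : G -> X -> X) : Prop :=
  continuous (fun p : G * X => T p.1 p.2) /\
  forall g k : G, T g \o T k = T (g * k)%g.

Variable T : G -> X -> X.

Definition invariant_measures : set (probability (borel X) R) :=
  [set mu | forall (g : G) (A : set (borel X)),
     measurable A -> mu (T g @^-1` A) = mu A].

(* Almost invariant sets are tested, rather than strictly invariant ones: for
   an uncountable acting semigroup the two conditions can differ. *)
Definition ergodic_measures : set (probability (borel X) R) :=
  [set mu | invariant_measures mu /\
     forall A : set (borel X), measurable A ->
       (forall g : G, mu ((T g @^-1` A) `+` A) = 0%E) ->
       mu A = 0%E \/ mu A = 1%E].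

(* [h] stands for the entropy; only its values on invariant measures matter. *)
Variable h : probability (borel X) R -> R.

(* [lam] is the convex combination of [mu] and [nu]. Equality is only required
   on Borel sets, the values of a library measure elsewhere being irrelevant;
   with [mu = nu], the condition thus also says that [h] does not depend on
   these values. *)
Definition affine_entropy : Prop :=
  forall (mu nu lam : probability (borel X) R) (t : R),
    invariant_measures mu -> invariant_measures nu ->
    invariant_measures lam -> 0 <= t <= 1 ->
    (forall A : set (borel X), measurable A ->
       lam A = (t%:E * mu A + (1 - t)%:E * nu A)%E) ->
    h lam = t * h mu + (1 - t) * h nu.

Definition topological_entropy : \bar R :=
  ereal_sup [set (h mu)%:E | mu in invariant_measures].

Definition pressure (phi : X -> R) : \bar R :=
  ereal_sup [set (h mu + \int[mu]_x phi x)%:E | mu in invariant_measures].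

Definition equilibrium_state (phi : X -> R) (mu : probability (borel X) R) :
    Prop :=
  invariant_measures mu /\
  pressure phi = (h mu + \int[mu]_x phi x)%:E.

Definition freezes_at (phi : X -> R) (mu : probability (borel X) R) : Prop :=
  exists2 beta0 : R, 0 < beta0 &
    forall beta : R, beta0 <= beta ->
      equilibrium_state (fun x => beta * phi x) mu.

End Dynamics.

(* Main.v *)
Require Import Defs.
From HB Require Import structures.
From mathcomp Require Import all_boot all_order all_algebra.
From mathcomp Require Import all_classical all_reals all_analysis.
From mathcomp Require Import measurable_realfun ring lra.
Import Order.TTheory GRing.Theory Num.Theory.
Import numFieldNormedType.Exports.
Local Open Scope classical_set_scope.
Local Open Scope ring_scope.

(* If mu is an equilibrium state for phi, put l x = \int phi dmu - phi x, so
   that h nu - h mu <= \int l dnu for every invariant nu, with equality at mu.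
   It suffices to find a continuous u with \int u dmu = 0 and
   \int u dnu >= max (0, \int l dnu) for every invariant nu: then -u freezes at
   mu, with threshold 1. Averages of a function along the action have the same
   integrals against invariant measures, and by the mean ergodic theorem some
   average of l, hence its positive part, has small norm in L^1(mu). Iterating
   this, each time truncating so as to change the integrals against all invariant
   measures by at most a summable error, gives u as a uniform limit. *)

(** * Summable series, and means under a probability measure *)

Lemma summable_cvg_series (R : realType) (u : R^nat) :
  (\sum_(n <oo) `|u n|%:E < +oo)%E -> cvgn (series u).
Proof.
move=> uoo; apply: normed_cvg; apply: nondecreasing_is_cvgn.
  by apply: nondecreasing_series => n _ _; exact: normr_ge0.
have u0 : (0 <= \sum_(n <oo) `|u n|%:E)%E.
  by apply: nneseries_ge0 => n _ _; rewrite lee_fin.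
exists (fine (\sum_(n <oo) `|u n|%:E)%E) => _ [n _ <-].
rewrite -lee_fin fineK ?ge0_fin_numE// /series/= -sumEFin.
by apply: nneseries_lim_ge => k _ _; rewrite lee_fin.
Qed.

(** By Tonelli, the sum of the [|u n|] has finite integral, so it is finite almost everywhere, and
    the series converges absolutely there. *)
Lemma ae_cvg_series d (T : measurableType d) (R : realType)
    (mu : {measure set T -> \bar R}) (u : (T -> R)^nat) :
  (forall n, measurable_fun setT (u n)) ->
  (\sum_(n <oo) \int[mu]_x `|u n x|%:E < +oo)%E ->
  {ae mu, forall x, cvgn (series (u ^~ x))}.
Proof.
move=> mu_ uoo.
have mabs n : measurable_fun setT (fun x => (`|u n x|%:E : \bar R)).
  by apply/measurable_EFinP; exact: measurableT_comp.
have abs0 n x : (0 <= `|u n x|%:E :> \bar R)%E by rewrite lee_fin.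
have mS : measurable_fun setT (fun x => \sum_(n <oo) (`|u n x|%:E : \bar R))%E.
  by apply: ge0_emeasurable_sum.
have iS : mu.-integrable setT (fun x => \sum_(n <oo) (`|u n x|%:E : \bar R))%E.
  apply/integrableP; split => //.
  under eq_integral => x _.
    rewrite gee0_abs; last exact: nneseries_ge0.
    over.
  by rewrite integral_nneseries.
apply: filterS (integrable_ae measurableT iS) => x /(_ Logic.I).
rewrite ge0_fin_numE; last exact: nneseries_ge0.
exact: summable_cvg_series.
Qed.

Lemma Rintegral_probability_cst d (T : measurableType d) (R : realType)
    (P : probability T R) (r : R) : \int[P]_x r = r.
Proof.
rewrite Rintegral_cst// [X in fine X](_ : _ = 1%E) ?mulr1//.
exact: probability_setT.
Qed.

(** Otherwise [Y] minus its mean would be positive almost everywhere with integral zero, hence zero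
    almost everywhere. This excludes the measure-one alternative when ergodicity is applied to a
    level set. *)
Lemma probability_gt_mean d (T : measurableType d) (R : realType)
    (P : probability T R) (Y : T -> R) : P.-integrable setT (EFin \o Y) ->
  P [set x | \int[P]_y Y y < Y x] <> 1%E.
Proof.
move=> iY; set m := \int[P]_y Y y => Pgt1.
have mY : measurable_fun setT Y by apply/measurable_EFinP/(measurable_int P).
have mgt : measurable [set x | m < Y x].
  rewrite -[X in measurable X]setTI -preimage_itvoy.
  exact: mY.
have iYm : P.-integrable setT (EFin \o (fun x => Y x - m)).
  apply: (@integrableB _ _ _ P setT _ (EFin \o Y) (EFin \o cst m)) => //.
  exact: finite_measure_integrable_cst.
have intYm : (\int[P]_x (Y x - m)%:E = 0)%E.
  rewrite -[LHS]fineK ?integrable_fin_num//.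
  rewrite -[fine _]/(\int[P]_x (Y x - m)) RintegralB//.
    by rewrite Rintegral_probability_cst subrr.
  exact: finite_measure_integrable_cst.
have aegt : {ae P, forall x, m < Y x}.
  exists (~` [set x | m < Y x]); split => //; first exact: measurableC.
  by rewrite probability_setC// Pgt1 subee.
have /ae_eq_integral_abs : (\int[P]_x `|(Y x - m)%:E| = 0)%E.
  rewrite -intYm; apply: ae_eq_integral => //.
  - by apply: measurableT_comp => //; exact: measurable_int iYm.
  - exact: measurable_int iYm.
  - apply: filterS aegt => x mYx _.
    by rewrite gee0_abs// lee_fin subr_ge0 ltW.
move=> /(_ measurableT (measurable_int _ iYm)) Ym0.
have /negligibleP : P.-negligible [set x | m < Y x].
  apply: negligibleS Ym0 => x /= mYx /(_ Logic.I) [] /eqP.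
  by rewrite subr_eq0 gt_eqF.
move=> /(_ mgt) Pgt0; have : 1%E = 0%E :> \bar R by rewrite -Pgt1; exact: Pgt0.
by move/eqP; rewrite onee_eq0.
Qed.

(** * Integration of continuous functions on a compact space *)

Section continuous_integral.
Context {R : realType} {X : pmetricType R}.
Hypothesis X_compact : compact [set: X].
Implicit Types (f : X -> R) (nu : probability (borel X) R).

Lemma continuous_borel_measurable f :
  continuous f -> measurable_fun [set: borel X] (f : borel X -> R).
Proof.
move=> /continuousP cf.
apply: (measurability _ (RGenOpens.measurableE R)).
move=> _ [_ [a [b ->] <-]]; rewrite setTI; apply: sub_sigma_algebra.
exact/cf/interval_open.
Qed.

Lemma continuous_bound f :
  continuous f -> exists M : R, forall x, `|f x| <= M.
Proof.
move=> cf.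
have [] := @compact_EVT_max _ R (fun x => `|f x|) [set: X] _ X_compact.
- by exists point.
- by apply: continuous_subspaceT => x; apply: cvg_norm; exact: cf.
by move=> c _ cM; exists `|f c| => // x; apply: cM; rewrite inE.
Qed.

Lemma continuous_integrable nu f :
  continuous f -> nu.-integrable setT (EFin \o f).
Proof.
move=> cf; apply: measurable_bounded_integrable => //.
- by rewrite ltey_eq fin_num_measure.
- exact: continuous_borel_measurable.
have [M fM] := continuous_bound f cf.
exists M; split; first exact: num_real.
by move=> y My x _; apply: le_trans (ltW My); exact: fM.
Qed.

(** * Invariance of integrals, and averages along the action *)

Context {G : topologicalSemigroupType} (T : G -> X -> X).
Hypothesis T_action : continuous_action T.

Lemma action_continuous g : continuous (T g).
Proof.
case: T_action => cT _ x.
apply: (@continuous_comp _ _ _ (fun y => (g, y)) (fun p => T p.1 p.2)).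
  by apply: cvg_pair; [exact: cvg_cst|exact: cvg_id].
exact: cT.
Qed.

Lemma action_measurable g :
  measurable_fun [set: borel X] (T g : borel X -> borel X).
Proof.
have measT := @measurability _ _ (borel X) (borel X) setT (T g) (@open X) erefl.
apply: (measT _) => _ [B oB <-]; rewrite setTI.
apply: sub_sigma_algebra.
by move/continuousP : (action_continuous g); exact.
Qed.

Lemma integral_action nu f g : invariant_measures T nu -> continuous f ->
  \int[nu]_x f (T g x) = \int[nu]_x f x.
Proof.
move=> inv_nu cf; congr fine.
have cfT : continuous (f \o T g).
  by move=> x; apply: continuous_comp; [exact: action_continuous|exact: cf].
have mf : measurable_fun [set: borel X] (EFin \o (f : borel X -> R)).
  by apply/measurable_EFinP; exact: continuous_borel_measurable.
have -> : (\int[nu]_x (f (T g x))%:E =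
    \int[pushforward nu (T g : borel X -> borel X)]_(y in [set: borel X])
      (f y)%:E)%E.
  rewrite (integral_pushforward (action_measurable g) mf _ measurableT)//.
  exact: (continuous_integrable nu _ cfT).
apply: eq_measure_integral => [|?]; first exact: action_measurable.
by move=> B mB _; exact: inv_nu.
Qed.

(** Dyadic convex combinations of the identity and of translations. They are operators rather than
    functions, so that the same average can act on several functions; midpoints are what the
    parallelogram law calls for. *)
Inductive averaging : ((X -> R) -> X -> R) -> Prop :=
| averaging_id : averaging id
| averaging_action A g : averaging A -> averaging (fun f => A f \o T g)
| averaging_midpoint A B : averaging A -> averaging B ->
    averaging (fun f x => 2^-1 * (A f x + B f x)).

Lemma averaging_comp A B : averaging A -> averaging B -> averaging (A \o B).
Proof.
move=> avA avB; elim: avA => [//|{}A g _ IH|A1 A2 _ IH1 _ IH2].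
- exact: averaging_action IH.
- exact: averaging_midpoint IH1 IH2.
Qed.

Lemma averaging_continuous A f :
  averaging A -> continuous f -> continuous (A f).
Proof.
move=> avA cf; elim: avA => [//|{}A g _ IH|A1 A2 _ IH1 _ IH2] x.
- by apply: continuous_comp; [exact: action_continuous|exact: IH].
- by apply: cvgM; [exact: cvg_cst|apply: cvgD; [exact: IH1|exact: IH2]].
Qed.

Lemma averaging_le A f (g : X -> R) : averaging A ->
  (forall x, f x <= g x) -> forall x, A f x <= A g x.
Proof.
move=> avA fg; elim: avA => [//|{}A a _ IH|A1 A2 _ IH1 _ IH2] x /=.
- exact: IH.
- by rewrite ler_wpM2l ?invr_ge0// lerD.
Qed.

Lemma averaging_bound A f M : averaging A ->
  (forall x, `|f x| <= M) -> forall x, `|A f x| <= M.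
Proof.
move=> avA fM; elim: avA => [//|{}A a _ IH|A1 A2 _ IH1 _ IH2] x /=.
- exact: IH.
- by move: (IH1 x) (IH2 x); rewrite !ler_norml; lra.
Qed.

Lemma averaging_integral A nu f : averaging A -> invariant_measures T nu ->
  continuous f -> \int[nu]_x A f x = \int[nu]_x f x.
Proof.
move=> avA inv_nu cf; elim: avA => [//|{}A g avA IH|A1 A2 av1 IH1 av2 IH2].
- by rewrite -IH integral_action//; exact: averaging_continuous.
- have i1 := continuous_integrable nu _ (averaging_continuous _ _ av1 cf).
  have i2 := continuous_integrable nu _ (averaging_continuous _ _ av2 cf).
  rewrite RintegralZl// ?RintegralD// ?IH1 ?IH2; first lra.
  exact: (@integrableD _ _ _ nu setT _ _ _ i1 i2).
Qed.

Lemma continuous_norm f : continuous f -> continuous (fun x => `|f x|).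
Proof. by move=> cf x; apply: cvg_norm; exact: cf. Qed.

Lemma averaging_norm A f x : averaging A ->
  `|A f x| <= A (fun y => `|f y|) x.
Proof.
move=> avA; elim: avA x => [//|{}A a _ IH|A1 A2 _ IH1 _ IH2] x /=.
- exact: IH.
- by move: (IH1 x) (IH2 x); rewrite !ler_norml; lra.
Qed.

(** Pointwise, [|A f|] is at most the average of [|f|], whose integral is that of [|f|]. Hence a
    further average never spoils smallness in [L^1]. *)
Lemma averaging_integral_norm A nu f : averaging A ->
  invariant_measures T nu -> continuous f ->
  \int[nu]_x `|A f x| <= \int[nu]_x `|f x|.
Proof.
move=> avA inv_nu cf.
have cn := continuous_norm _ cf.
rewrite -[leRHS](averaging_integral A)//; apply: le_Rintegral => //.
- apply: continuous_integrable; apply: continuous_norm.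
  exact: averaging_continuous.
- by apply: continuous_integrable; exact: averaging_continuous.
- by move=> x _; exact: averaging_norm.
Qed.

(** * Mean ergodic theorem *)

Lemma EFin_continuous_integral nu f : continuous f ->
  (\int[nu]_x (f x)%:E)%E = (\int[nu]_x f x)%:E.
Proof.
move=> cf; rewrite /Rintegral fineK//; apply: integrable_fin_num => //.
exact: continuous_integrable.
Qed.

(** Level sets of [c] are almost invariant, so they have measure zero or one; those strictly above
    and strictly below the mean cannot have measure one. *)
Lemma ergodic_ae_cst nu (c : borel X -> R) : ergodic_measures T nu ->
  nu.-integrable setT (EFin \o c) ->
  (forall g, {ae nu, forall x, c (T g x) = c x}) ->
  {ae nu, forall x, c x = \int[nu]_y c y}.
Proof.
move=> [_ erg] ic c_inv; set m := \int[nu]_y c y.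
have mc : measurable_fun [set: borel X] c.
  by apply/measurable_EFinP; exact: measurable_int ic.
have null01 (P : set R) : measurable P -> nu (c @^-1` P) <> 1%E ->
    nu (c @^-1` P) = 0%E.
  move=> mP P1.
  have mcP : measurable (c @^-1` P).
    by rewrite -[X in measurable X]setTI; exact: mc.
  suff nullY : forall g, nu ((T g @^-1` (c @^-1` P)) `+` (c @^-1` P)) = 0%E.
    by case: (erg _ mcP nullY).
  move=> g.
  have mTcP : measurable (T g @^-1` (c @^-1` P) : set (borel X)).
    by rewrite -[X in measurable X]setTI; exact: (action_measurable g).
  apply: measure_negligible.
    by apply: measurableU; apply: measurableD.
  apply: negligibleS (c_inv g) => x /= [] [] + + cx; rewrite /= cx//.
have gt0 : nu [set x | m < c x] = 0%E.
  have -> : [set x | m < c x] = c @^-1` `]m, +oo[.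
    by apply/seteqP; split => x /=; rewrite in_itv/= andbT.
  apply: null01 => //; rewrite preimage_itvoy.
  exact: (probability_gt_mean _ _ _ nu c).
have lt0 : nu [set x | c x < m] = 0%E.
  have -> : [set x | c x < m] = c @^-1` `]-oo, m[.
    by apply/seteqP; split => x /=; rewrite in_itv.
  apply: null01 => //.
  (* The set below the mean of [c] is the set above the mean of [- c]. *)
  have iNc : nu.-integrable setT (EFin \o (fun x => - c x)).
    exact: (integrableN ic).
  have mN : \int[nu]_y (- c y) = - m.
    under eq_Rintegral do rewrite -mulN1r.
    by rewrite RintegralZl// mulN1r.
  have := probability_gt_mean _ _ _ nu _ iNc; rewrite mN.
  have -> // : c @^-1` `]-oo, m[ = [set x | - m < - c x].
  by apply/seteqP; split => x /=; rewrite in_itv/= ltrN2.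
have : nu.-negligible ([set x | m < c x] `|` [set x | c x < m]).
  apply: negligibleU; apply/negligibleP => //.
    by rewrite -preimage_itvoy -[X in measurable X]setTI; exact: mc.
  by rewrite -preimage_itvNyo -[X in measurable X]setTI; exact: mc.
by apply: negligibleS => x /= /eqP; rewrite neq_lt => /orP[]; [right|left].
Qed.

(* The parallelogram law, combined with [`|a - b| <= (e + (a - b)^2 / e) / 2]. *)
Lemma averaging_near_minimizers nu f (I e : R) A B : continuous f -> 0 < e ->
  (forall C, averaging C -> I <= \int[nu]_x (C f x) ^+ 2) ->
  averaging A -> averaging B ->
  \int[nu]_x (A f x) ^+ 2 <= I + e ^+ 2 / 4 ->
  \int[nu]_x (B f x) ^+ 2 <= I + e ^+ 2 / 4 ->
  \int[nu]_x `|A f x - B f x| <= e.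
Proof.
move=> cf e0 I_le avA avB NA NB.
have cont C : averaging C -> continuous (C f).
  by move=> avC; exact: averaging_continuous.
have sq C : averaging C -> continuous (fun x => (C f x) ^+ 2).
  move=> avC x; rewrite /continuous_at expr2.
  under eq_fun do rewrite expr2.
  by apply: cvgM; exact: cont.
pose M := fun (h : X -> R) x => 2^-1 * (A h x + B h x).
have avM : averaging M := averaging_midpoint _ _ avA avB.
have iC C : averaging C ->
    nu.-integrable setT (EFin \o (fun x => e^-1 * (C f x) ^+ 2)).
  move=> avC; apply: continuous_integrable => x.
  by apply: cvgM; [exact: cvg_cst|exact: sq].
have iAB : nu.-integrable setT
    (EFin \o (fun x => e^-1 * (A f x) ^+ 2 + e^-1 * (B f x) ^+ 2)).
  exact: (@integrableD _ _ _ nu setT _ _ _ (iC _ avA) (iC _ avB)).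
have i2M : nu.-integrable setT
    (EFin \o (fun x => 2 * (e^-1 * (M f x) ^+ 2))).
  exact: (@integrableZl _ _ _ nu setT _ _ _ (iC _ avM)).
have ie : nu.-integrable setT (EFin \o cst (e / 2)).
  by apply: continuous_integrable => x; exact: cvg_cst.
have iD : nu.-integrable setT (EFin \o (fun x => e^-1 * (A f x) ^+ 2 +
    e^-1 * (B f x) ^+ 2 - 2 * (e^-1 * (M f x) ^+ 2))).
  exact: (@integrableB _ _ _ nu setT _ _ _ iAB i2M).
apply: (@le_trans _ _ (\int[nu]_x (e / 2 + (e^-1 * (A f x) ^+ 2 +
    e^-1 * (B f x) ^+ 2 - 2 * (e^-1 * (M f x) ^+ 2))))).
  apply: le_Rintegral => //.
  - apply: continuous_integrable; apply: continuous_norm => x.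
    by apply: cvgB; exact: cont.
  - exact: (@integrableD _ _ _ nu setT _ _ _ ie iD).
  - move=> x _; rewrite /M; set a := A f x; set b := B f x.
    rewrite (_ : _ + _ = (e + e^-1 * `|a - b| ^+ 2) / 2); last first.
      by rewrite real_normK ?num_real//; field; rewrite gt_eqF.
    set t := `|a - b|.
    rewrite -subr_ge0 (_ : _ - _ = e^-1 * (e - t) ^+ 2 / 2); last first.
      by field; rewrite gt_eqF.
    by rewrite divr_ge0// mulr_ge0 ?sqr_ge0// invr_ge0 ltW.
rewrite RintegralD// Rintegral_probability_cst RintegralB// RintegralD ?iC//.
rewrite !RintegralZl// ?iC//; try exact: continuous_integrable (sq _ _).
(* The midpoint is itself an average, so its squared norm is at least [I]. With the tolerance
   [e ^+ 2 / 4] for [A] and [B], the defect [a + b - 2 * c] is at most [e ^+ 2 / 2]. *)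
have NM := I_le _ avM.
set a := \int[nu]_x _ in NA *; set b := \int[nu]_x _ in NB *.
set c := \int[nu]_x _ in NM *.
rewrite -subr_ge0 (_ : _ - _ = e^-1 * (e ^+ 2 / 2 - a - b + 2 * c)); last first.
  by field; rewrite gt_eqF.
by rewrite mulr_ge0 ?invr_ge0 ?(ltW e0)//; lra.
Qed.

(* Following Alaoglu and Birkhoff, averages of [f] of nearly minimal norm in
   [L^2] form a Cauchy sequence whose limit is invariant; this needs no
   commutativity or amenability of the semigroup. *)
Lemma averaging_mean_ergodic nu f (eps : R) : ergodic_measures T nu ->
  continuous f -> 0 < eps ->
  exists2 A, averaging A & \int[nu]_x `|A f x - \int[nu]_y f y| <= eps.
Proof.
move=> erg cf eps0; have [inv_nu _] := erg.
pose N (A : (X -> R) -> X -> R) := \int[nu]_x (A f x) ^+ 2.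
pose S := [set N A | A in averaging].
have S_lb : lbound S 0.
  by move=> _ [A _ <-]; apply: Rintegral_ge0 => x _; exact: sqr_ge0.
have S_inf : has_inf S.
  by split; [exists (N id); exists id => //; exact: averaging_id|exists 0].
have I_le C : averaging C -> inf S <= N C.
  by move=> avC; apply: ge_inf; [exists 0|exists C].
(* These tolerances have sum one, so differences bounded by them in [L^1] form a series converging
   almost everywhere. *)
pose e n : R := 1 / (2 ^ n.+1)%:R.
have e_gt0 n : 0 < e n by rewrite divr_gt0// ltr0n expn_gt0.
have e_le n : e n.+1 <= e n.
  by rewrite ler_pM2l// lef_pV2 ?posrE ?ltr0n ?expn_gt0// ler_nat leq_exp2l.
have /choice[A_ A_P] n : exists A, averaging A /\ N A <= inf S + e n ^+ 2 / 4.
  have [|_ [A avA <-] /ltW NA] := @inf_adherent _ S (e n ^+ 2 / 4) _ S_inf.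
    by rewrite divr_gt0// exprn_gt0.
  by exists A.
pose f_ n := A_ n f.
have cf_ n : continuous (f_ n).
  by apply: averaging_continuous => //; exact: (A_P n).1.
have [M fM] := continuous_bound f cf.
have f_M n x : `|f_ n x| <= M.
  by apply: averaging_bound => //; exact: (A_P n).1.
have ae_series (u : nat -> X -> R) : (forall n, continuous (u n)) ->
    (forall n, \int[nu]_x `|u n x| <= e n) ->
    {ae nu, forall x, cvgn (series (u ^~ x))}.
  move=> cu ue; apply: ae_cvg_series => [n|].
    exact: continuous_borel_measurable.
  apply: (@le_lt_trans _ _ 1%E); last exact: ltry.
  apply: le_trans (epsilon_trick0 xpredT (@ler01 R)).
  apply: lee_nneseries => [n _ _|n _]; first exact: integral_ge0.
  by rewrite EFin_continuous_integral ?lee_fin//; exact: continuous_norm.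
have step n : \int[nu]_x `|f_ n.+1 x - f_ n x| <= e n.
  apply: (@averaging_near_minimizers _ _ (inf S)) => //.
  - exact: (A_P _).1.
  - exact: (A_P _).1.
  - apply: le_trans (A_P _).2 _.
    rewrite lerD2l ler_pM2r ?invr_gt0//; apply: lerXn2r => //.
      by rewrite nnegrE ltW.
    by rewrite nnegrE ltW.
  - exact: (A_P _).2.
(* By invariance, translation by [T g] preserves the [L^2] norm, so the translate of [f_ n] is as
   close to minimal as [f_ n]. *)
have shift g n : \int[nu]_x `|f_ n (T g x) - f_ n x| <= e n.
  apply: (@averaging_near_minimizers _ _ (inf S) _ (fun h => A_ n h \o T g)
      (A_ n)) => //.
  - apply: averaging_action; exact: (A_P _).1.
  - exact: (A_P _).1.
  - rewrite [leLHS](_ : _ = N (A_ n)); first exact: (A_P _).2.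
    apply: (integral_action nu (fun x => (f_ n x) ^+ 2)) => // x.
    rewrite /continuous_at expr2; under eq_fun do rewrite expr2.
    by apply: cvgM; exact: cf_.
  - exact: (A_P _).2.
have ae_filter : Filter (nbhs (almost_everywhere nu)).
  exact: ae_filter_ringOfSetsType.
(* The upper limit is defined everywhere and measurable, and it is the limit wherever the sequence
   converges. *)
pose c x := limn_sup (f_ ^~ x).
have f_cvg : {ae nu, forall x, f_ ^~ x @ \oo --> c x}.
  apply: filterS (ae_series (fun n x => f_ n.+1 x - f_ n x) _ step); last first.
    by move=> n x; apply: cvgB; exact: cf_.
  move=> x /= cs.
  have cv : cvgn (f_ ^~ x).
    rewrite (_ : f_ ^~ x = fun n => f_ 0%N x + series (telescope (f_ ^~ x)) n).
      by apply: is_cvgD => //; exact: is_cvg_cst.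
    by apply/funext => n; rewrite [LHS](eq_sum_telescope (f_ ^~ x)).
  by rewrite /c cvg_limn_supE.
have c_inv g : {ae nu, forall x, c (T g x) = c x}.
  have shift0 := ae_series (fun n x => f_ n (T g x) - f_ n x) _ (shift g).
  apply: filterS2 f_cvg (shift0 _) => [x fx /cvg_series_cvg_0 fTx|n x]; last first.
    apply: cvgB; last exact: cf_.
    by apply: continuous_comp; [exact: action_continuous|exact: cf_].
  have fTcx : f_ ^~ (T g x) @ \oo --> c x.
    rewrite -[c x]add0r (_ : f_ ^~ (T g x) =
      fun n => (f_ n (T g x) - f_ n x) + f_ n x); first exact: cvgD.
    by apply/funext => n; rewrite subrK.
  rewrite /c cvg_limn_supE; last by apply/cvg_ex; exists (c x).
  exact/cvg_lim.
have mf_ n : measurable_fun [set: borel X] (EFin \o (f_ n : borel X -> R)).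
  by apply/measurable_EFinP; exact: continuous_borel_measurable.
have mc : measurable_fun [set: borel X] (EFin \o (c : borel X -> R)).
  apply/measurable_EFinP; apply: measurable_fun_limn_sup => [x _|x _|n].
  - by exists M => _ [n _ <-]; have := f_M n x; rewrite ler_norml => /andP[].
  - by exists (- M) => _ [n _ <-]; have := f_M n x; rewrite ler_norml => /andP[].
  - exact: continuous_borel_measurable.
have [|||ic _ int_cvg] := @dominated_convergence _ _ _ nu setT measurableT
  (fun n => EFin \o f_ n) (EFin \o c) (EFin \o cst M) mf_ mc.
- apply: filterS f_cvg => x fx _; apply: cvg_EFin; first exact: nearW.
  exact: fx.
- exact: finite_measure_integrable_cst.
- by apply: aeW => x n _; rewrite lee_fin.
set m := \int[nu]_y f y.
(* Every [f_ n] has integral [m], and domination by [M] lets the limit pass under the integral. *)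
have cm : \int[nu]_y c y = m.
  apply: (@EFin_inj R); rewrite /Rintegral fineK; last exact: integrable_fin_num.
  apply/esym/(cvg_unique _ _ int_cvg) => //.
  rewrite (_ : (fun n => _) = cst m%:E); first exact: cvg_cst.
  apply/funext => n; rewrite /= EFin_continuous_integral//.
  by rewrite averaging_integral//; exact: (A_P n).1.
have ae_m : {ae nu, forall x, f_ ^~ x @ \oo --> m}.
  apply: filterS2 f_cvg (ergodic_ae_cst nu c erg ic c_inv) => x fx.
  by rewrite cm => <-.
(* Now that the limit is known to be the constant [m], dominated convergence gives convergence in
   [L^1]. *)
have [|||_ L1_cvg _] := @dominated_convergence _ _ _ nu setT measurableT
  (fun n => EFin \o f_ n) (EFin \o cst m) (EFin \o cst M) mf_
  (measurable_cst m%:E).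
- apply: filterS ae_m => x fx _; apply: cvg_EFin; first exact: nearW.
  exact: fx.
- exact: finite_measure_integrable_cst.
- by apply: aeW => x n _; rewrite lee_fin.
have L1_cvg_fine : (fun n => \int[nu]_x `|f_ n x - m|) @ \oo --> 0.
  exact: fine_cvg L1_cvg.
have [n _ /(_ n (leqnn n))] := cvgr_lt _ L1_cvg_fine _ eps0.
by move=> /ltW ?; exists (A_ n) => //; exact: (A_P n).1.
Qed.

(** * Uniform limits and construction of the majorant *)

Lemma le_integral_add nu f (g : X -> R) (e : R) :
  continuous f -> continuous g -> (forall x, f x <= g x + e) ->
  \int[nu]_x f x <= \int[nu]_x g x + e.
Proof.
move=> cf cg fge.
have cst_int : nu.-integrable setT (EFin \o cst e).
  by apply: continuous_integrable => x; exact: cvg_cst.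
have g_int := continuous_integrable nu _ cg.
rewrite -[X in _ <= _ + X](Rintegral_probability_cst _ _ _ nu) -RintegralD//.
apply: le_Rintegral => //; first exact: continuous_integrable.
exact: (@integrableD _ _ _ nu setT _ _ _ g_int cst_int).
Qed.

Lemma divr_exprn_lt (C e : R) : 0 < e -> exists n, C / 2 ^+ n < e.
Proof.
move=> e0; exists (Num.bound (C / e)).
rewrite ltr_pdivrMr ?exprn_gt0// mulrC -ltr_pdivrMr//.
exact: upper_nthrootP.
Qed.

(** The bound [2 * C / 2 ^+ n] is the tail from [n] on of the geometric series of increments; being
    uniform in [x], it makes the limit continuous. *)
Lemma geometric_cvg_uniform (s : nat -> X -> R) (C : R) :
  0 <= C -> (forall n, continuous (s n)) ->
  (forall n x, `|s n.+1 x - s n x| <= C / 2 ^+ n) ->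
  exists2 u : X -> R, continuous u &
    forall n x, `|u x - s n x| <= 2 * C / 2 ^+ n.
Proof.
move=> C0 cs sC.
have s_cvg x : cvgn (s ^~ x).
  rewrite (_ : s ^~ x = fun n => s 0%N x + series (telescope (s ^~ x)) n).
    apply: is_cvgD; first exact: is_cvg_cst.
    apply: summable_cvg_series; apply: (@le_lt_trans _ _ (2 * C)%:E).
      apply: le_trans (epsilon_trick0 xpredT _); last by rewrite mulr_ge0.
      apply: lee_nneseries => [n _ _|n _]; first by rewrite lee_fin.
      rewrite lee_fin; apply: le_trans (sC n x) _.
      by rewrite natrX exprS -mulf_div divff// mul1r.
    exact: ltry.
  by apply/funext => n; rewrite [LHS](eq_sum_telescope (s ^~ x)).
have s_dist n k x : `|s (n + k)%N x - s n x| <= 2 * C / 2 ^+ n.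
  (* The partial geometric sum, written as a difference of two tails, carries the induction on
     [k]. *)
  suff : `|s (n + k)%N x - s n x| <= 2 * C / 2 ^+ n - 2 * C / 2 ^+ (n + k).
    by move=> /le_trans; apply; rewrite gerBl divr_ge0 ?mulr_ge0 ?exprn_ge0.
  elim: k => [|k IH]; first by rewrite addn0 !subrr normr0.
  rewrite addnS -(subrKA (s (n + k)%N x)).
  apply: le_trans (ler_normD _ _) _; apply: le_trans (lerD (sC _ _) IH) _.
  rewrite le_eqVlt; apply/orP; left; apply/eqP.
  by rewrite exprS; field; rewrite !expf_neq0.
pose u x := limn (s ^~ x).
have u_dist n x : `|u x - s n x| <= 2 * C / 2 ^+ n.
  have s_lim : (fun k => `|s (k + n)%N x - s n x|) @ \oo --> `|u x - s n x|.
    apply: cvg_norm; apply: cvgB; last exact: cvg_cst.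
    by rewrite (cvg_shiftn n (s ^~ x)); exact: s_cvg.
  by apply: (cvgr_to_le s_lim); apply: nearW => k; rewrite addnC.
exists u => // x; apply/cvgrPdist_lt => e e0.
have [n Cn] := divr_exprn_lt (2 * C) _ (divr_gt0 e0 (ltr0n R 3)).
have /cvgrPdist_lt/(_ (e / 3) (divr_gt0 e0 (ltr0n R 3))) := cs n x.
apply: filterS => y sxy.
have := u_dist n x; have := u_dist n y; move: sxy.
rewrite ltr_norml => /andP[? ?]; rewrite !ler_norml => /andP[? ?] /andP[? ?].
by rewrite ltr_norml; apply/andP; split; lra.
Qed.

Lemma continuous_maxr f (g : X -> R) : continuous f -> continuous g ->
  continuous (fun x => Num.max (f x) (g x)).
Proof. by move=> cf cg x; exact: continuous_max (cf x) (cg x). Qed.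

(** The iteration halves a bound on the integral against [mu] of a function dominating both zero and
    an average of [l]. The domination yields the inequalities for all invariant measures; at [mu]
    they force the integral of [u] to vanish. *)
Lemma exists_invariant_majorant mu (l : X -> R) :
  ergodic_measures T mu -> continuous l -> \int[mu]_x l x = 0 ->
  exists u : X -> R, [/\ continuous u, \int[mu]_x u x <= 0 &
    forall nu, invariant_measures T nu ->
      0 <= \int[nu]_x u x /\ \int[nu]_x l x <= \int[nu]_x u x].
Proof.
move=> erg cl l0; have [inv_mu _] := erg.
(* The summand 1 keeps every [d n] positive; the other one bounds the integral of the initial [f],
   the positive part of [l]. *)
pose C : R := 1 + \int[mu]_x Num.max 0 (l x).
have C1 : 1 <= C.
  by rewrite lerDl; apply: Rintegral_ge0 => x _; rewrite le_max lexx.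
pose d n : R := C / 2 ^+ n.
have d_gt0 n : 0 < d n.
  by rewrite divr_gt0 ?exprn_gt0//; exact: lt_le_trans C1.
(* In a state (f, k, s), k is an average of l, f is pointwise above max (0, k),
   and s, which has the same invariant integrals as f, converges uniformly: it
   changes by f' - A f, whereas f itself changes to f'. *)
pose valid n (st : (X -> R) * (X -> R) * (X -> R)) :=
  let: (f, k, s) := st in
  [/\ [/\ continuous f, continuous k & continuous s],
      forall x, 0 <= f x /\ k x <= f x,
      forall nu, invariant_measures T nu ->
        \int[nu]_x s x = \int[nu]_x f x /\ \int[nu]_x k x = \int[nu]_x l x &
      \int[mu]_x f x <= d n].
(* Validity is assumed under the existential, so that choice yields a total function on states. *)
have step (p : nat * ((X -> R) * (X -> R) * (X -> R))) :
    exists st', valid p.1 p.2 ->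
      valid p.1.+1 st' /\ forall x, `|st'.2 x - p.2.2 x| <= d p.1.
  move: p => [n [[f k] s]] /=.
  have [v|nv] := pselect (valid n (f, k, s)); last by exists (f, k, s).
  have [[cf ck cs] fk int_sk int_f] := v.
  have d2 : 0 < d n.+1 / 2 by rewrite divr_gt0.
  (* [A1] brings [k] near its mean, which is zero like that of [l]; then [A2] brings [A1 f] near its
     mean without increasing the norm of [A1 k]. Each error takes half of [d n.+1]. *)
  have [A1 av1 A1k] := averaging_mean_ergodic mu k _ erg ck d2.
  have cA1f : continuous (A1 f) by exact: averaging_continuous.
  have cA1k : continuous (A1 k) by exact: averaging_continuous.
  have [A2 av2 A2f] := averaging_mean_ergodic mu (A1 f) _ erg cA1f d2.
  pose A := A2 \o A1; have avA : averaging A by exact: averaging_comp.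
  have cAf : continuous (A f) by exact: averaging_continuous.
  have cAk : continuous (A k) by exact: averaging_continuous.
  have Ak_le : \int[mu]_x `|A k x| <= d n.+1 / 2.
    apply: le_trans (averaging_integral_norm A2 mu _ av2 inv_mu cA1k) _.
    move: A1k; rewrite (int_sk _ inv_mu).2 l0.
    by under eq_Rintegral do rewrite subr0.
  (* The terms [0] and [A k x] preserve domination; the last one keeps [f'] from falling more than
     [d n] below [A f]. Since the mean of [f] is at most [d n], the positive part of [A f - d n] is
     bounded by the distance from [A f] to its mean. *)
  pose f' x := Num.max 0 (Num.max (A k x) (A f x - d n)).
  have cf' : continuous f'.
    apply: continuous_maxr => [x|]; first exact: cvg_cst.
    apply: continuous_maxr => // x.
    by apply: cvgB; [exact: cAf|exact: cvg_cst].
  have cs' : continuous (fun x => s x + f' x - A f x).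
    by move=> x; apply: cvgB; [apply: cvgD; [exact: cs|exact: cf']|exact: cAf].
  exists (f', A k, fun x => s x + f' x - A f x) => _; split; first split => //.
  - by move=> x; rewrite /f' !le_max !lexx /= orbT.
  - move=> nu inv_nu; split; last first.
      by rewrite averaging_integral// (int_sk _ inv_nu).2.
    rewrite RintegralB ?RintegralD//; try exact: continuous_integrable.
      by rewrite averaging_integral// (int_sk _ inv_nu).1 addrC addKr.
    apply: continuous_integrable => x.
    by apply: cvgD; [exact: cs|exact: cf'].
  - have cAk1 := continuous_norm _ cAk.
    have cAf1 : continuous (fun x => `|A f x - \int[mu]_y A1 f y|).
      by apply: continuous_norm => x; apply: cvgB; [exact: cAf|exact: cvg_cst].
    rewrite (splitr (d n.+1)); apply: le_trans (lerD Ak_le A2f).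
    rewrite -RintegralD//; try exact: continuous_integrable.
    apply: le_Rintegral => //; first exact: continuous_integrable.
      apply: continuous_integrable => x.
      by apply: cvgD; [exact: cAk1|exact: cAf1].
    move=> x _; rewrite averaging_integral// !ge_max; apply/and3P; split.
    + by rewrite addr_ge0.
    + by rewrite (le_trans (ler_norm _))// lerDl.
    + apply: (@le_trans _ _ `|A f x - \int[mu]_x f x|); last by rewrite lerDr.
      by apply: le_trans (ler_norm _); rewrite lerB.
  - move=> x; have -> : s x + f' x - A f x - s x = f' x - A f x by ring.
    have [f0 kf] := (fun x => (fk x).1, fun x => (fk x).2).
    have Af0 : 0 <= A f x.
      have /= := averaging_le A (fun=> 0) f avA f0 x; apply: le_trans.
      have := averaging_bound A (fun=> 0) 0 avA _ x.
      rewrite normr0 => /(_ (fun=> lexx 0)); rewrite normr_le0 => /eqP ->.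
      exact: lexx.
    have AkAf : A k x <= A f x by exact: averaging_le.
    have dn := d_gt0 n.
    (* The lower bound is the last term of the maximum; the upper one holds because [A f] already
       dominates [0] and [A k]. *)
    rewrite ler_norml /f'; apply/andP; split.
      by rewrite lerBrDl !le_max lexx !orbT.
    rewrite lerBlDr !ge_max; apply/and3P; split; lra.
have [F F_P] := choice step.
pose st := fix st n := if n is n'.+1 then F (n', st n')
  else (fun x => Num.max 0 (l x), l, fun x => Num.max 0 (l x)).
have valid_st n : valid n (st n).
  elim: n => [|n /(F_P (n, _))[]//].
  have cl0 : continuous (fun x => Num.max 0 (l x)).
    by apply: continuous_maxr => // x; exact: cvg_cst.
  split => //; first by move=> x; rewrite !le_max !lexx orbT.
  by rewrite /d expr0 divr1 lerDr.
pose s n := (st n).2.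
have cs n : continuous (s n).
  by have := valid_st n; rewrite /s; case: (st n) => [[? ?] ?] [[]].
have sC n x : `|s n.+1 x - s n x| <= C / 2 ^+ n.
  exact: (F_P (n, st n) (valid_st n)).2.
have C0 : 0 <= C by exact: le_trans C1.
have [u cu us] := geometric_cvg_uniform s C C0 cs sC.
have int_s nu n : invariant_measures T nu ->
    [/\ 0 <= \int[nu]_x s n x & \int[nu]_x l x <= \int[nu]_x s n x].
  move=> inv_nu; have := valid_st n; rewrite /s.
  case: (st n) => [[f k] s'] [[cf ck _] fk /(_ _ inv_nu)[-> <-] _] /=.
  split; first by apply: Rintegral_ge0 => x _; exact: (fk x).1.
  apply: le_Rintegral => // [||x _]; try exact: continuous_integrable.
  exact: (fk x).2.
have int_mu_s n : \int[mu]_x s n x <= C / 2 ^+ n.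
  have := valid_st n; rewrite /s.
  by case: (st n) => [[f k] s'] [_ _ /(_ _ inv_mu)[-> _]].
have us_le n x : u x <= s n x + 2 * C / 2 ^+ n.
  by rewrite -lerBlDl; apply: le_trans (ler_norm _) (us n x).
have su_le n x : s n x <= u x + 2 * C / 2 ^+ n.
  by rewrite -lerBlDl; apply: le_trans (ler_norm _) _; rewrite distrC.
exists u; split => // [|nu inv_nu].
  apply/ler_addgt0Pr => e e0; rewrite add0r.
  (* One [C] bounds the integral of [s n], and [2 * C] the uniform distance from [s n] to [u]. *)
  have [n Cn] := divr_exprn_lt (3 * C) _ e0.
  have := le_integral_add mu _ _ _ cu (cs n) (us_le n).
  have := int_mu_s n; move: Cn; rewrite -!mulrA; lra.
split; apply/ler_addgt0Pr => e e0; have [n Cn] := divr_exprn_lt (2 * C) _ e0.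
  have := le_integral_add nu _ _ _ (cs n) cu (su_le n).
  by have [] := int_s nu n inv_nu; lra.
have := le_integral_add nu _ _ _ (cs n) cu (su_le n).
by have [] := int_s nu n inv_nu; lra.
Qed.
End continuous_integral.

(** * Equilibrium states and freezing *)

Theorem corollary2 (R : realType) (X : pmetricType R)
    (G : topologicalSemigroupType) (T : G -> X -> X)
    (h : probability (borel X) R -> R)
    (X_compact : compact [set: X])
    (T_action : continuous_action T)
    (MT_neq0 : invariant_measures T !=set0)
    (h_ge0 : forall nu, invariant_measures T nu -> 0 <= h nu)
    (h_affine : affine_entropy T h)
    (htop_finite : (topological_entropy T h < +oo)%E)
    (mu : probability (borel X) R) (mu_ergodic : ergodic_measures T mu) :
  (exists phi : X -> R, continuous phi /\ equilibrium_state T h phi mu) <->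
  (exists psi : X -> R, continuous psi /\ freezes_at T h psi mu).
Proof.
split=> [[phi [cphi [inv_mu phi_eq]]]|[psi [cpsi [b b0 /(_ b (lexx b)) eqb]]]];
  last first.
  (* A freezing potential is scaled by its threshold [b]. *)
  exists (fun x => b * psi x); split => // x.
  by apply: cvgM; [exact: cvg_cst|exact: cpsi].
have phi_le nu : invariant_measures T nu ->
    h nu + \int[nu]_x phi x <= h mu + \int[mu]_x phi x.
  move=> inv_nu; rewrite -lee_fin -phi_eq; apply: ereal_sup_ubound.
  by exists nu.
set m := \int[mu]_x phi x in phi_le *.
have int_l (nu : probability (borel X) R) :
    \int[nu]_x (m - phi x) = m - \int[nu]_x phi x.
  rewrite RintegralB// ?Rintegral_probability_cst//.
    by apply: continuous_integrable => // x; exact: cvg_cst.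
  exact: continuous_integrable.
have cl : continuous (fun x => m - phi x).
  by move=> x; apply: cvgB; [exact: cvg_cst|exact: cphi].
have [|u [cu u_mu u_nu]] :=
  exists_invariant_majorant X_compact T T_action mu (fun x => m - phi x)
    mu_ergodic cl.
  by rewrite int_l subrr.
exists (fun x => - u x); split; first by move=> x; apply: cvgN; exact: cu.
exists 1 => // beta beta1; split => //.
have int_u (nu : probability (borel X) R) :
    \int[nu]_x (beta * - u x) = - (beta * \int[nu]_x u x).
  under eq_Rintegral do rewrite mulrN -mulNr.
  by rewrite RintegralZl ?mulNr//; exact: continuous_integrable.
apply/le_anti/andP; split; last by apply: ereal_sup_ubound; exists mu.
(* With [l = m - phi], the gain [h nu - h mu] is at most the integral of [l] against [nu], hence at
   most that of [u], hence at most [beta] times the latter, as it is nonnegative and [1 <= beta]. *)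
apply: ge_ereal_sup => _ [nu inv_nu <-]; rewrite lee_fin !int_u.
have := phi_le nu inv_nu; have [] := u_nu nu inv_nu; rewrite int_l.
have [mu0 _] := u_nu mu inv_mu.
have -> : \int[mu]_x u x = 0 by apply/le_anti; rewrite u_mu.
rewrite mulr0 oppr0 addr0 => u0 lu hu.
have : \int[nu]_x u x <= beta * \int[nu]_x u x by rewrite ler_peMl.
lra.
Qed.
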